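(* Let $T=(\Omega,(\Pi_i,t_i)_{i\in N})$ be an information structure. The following three statements are equivalent: (1) there is no strong common prior for $T$; (2) there exists an acceptable trade over $T$; (3) every strongly maximal probability distribution $p\in\Delta(\Omega)$ is a strong multiplayer money pump.
   Context: $\Omega$ is a finite nonempty set of states, $N=\{1,\dots,n\}$ is a finite nonempty set of players, and $\Delta(\Omega)$ is the set of probability measures on $\Omega$ (all subsets measurable). An information structure is a tuple $T=(\Omega,(\Pi_i,t_i)_{i\in N})$ where, for each $i$, $\Pi_i$ is a partition of $\Omega$ and $t_i\colon\Omega\to\Delta(\Omega)$ satisfies $t_i(\omega)(\pi_i(\omega))=1$ for every $\omega$, where $\pi_i(\omega)$ is the element of $\Pi_i$ containing $\omega$, and $t_i$ is constant on each element of $\Pi_i$. A prior of player $i$ is a $p\in\Delta(\Omega)$ such that $p(E\cap\pi)=t_i(\omega)(E)\,p(\pi)$ for all $E\subseteq\Omega$, $\pi\in\Pi_i$, $\omega\in\pi$; a common prior is a $p\in\Delta(\Omega)$ that is a prior of every player. A distribution $p\in\Delta(\Omega)$ is strongly maximal if $p(\pi_i)>0$ for every $i\in N$ and every $\pi_i\in\Pi_i$; a strong common prior is a common prior $p$ with $p(\pi_i)>0$ for every $i\in N$ and every $\pi_i\in\Pi_i$. A nonempty set $S\subseteq\Omega$ is a common certainty component if for every $\omega\in S$ and $i\in N$ there is $E\subseteq S$ with $t_i(\omega)(E)=1$. An event $E\subseteq\Omega$ is commonly certain at $\omega$ if there is a common certainty component $S$ with $\omega\in S\subseteq E$. A trade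 is a family $f=(f_i)_{i\in N}$ of functions $f_i\colon\Omega\to\mathbb{R}$ with $\sum_{i\in N}f_i(\omega)\le 0$ for all $\omega\in\Omega$; it is acceptable if the event $\{\omega'\in\Omega:\int f_i\,\mathrm{d}t_i(\omega')\ge 0 \text{ for all } i\in N\}$ is commonly certain at every $\omega\in\Omega$, and there exist $\omega^*\in\Omega$ and $i^*\in N$ with $\int f_{i^*}\,\mathrm{d}t_{i^*}(\omega^* )>0$. A semi-trade is a family $(f_i)_{i\in N}$ of functions $f_i\colon\Omega\to\mathbb{R}$ such that at every state $\omega\in\Omega$ the event $\{\omega'\in\Omega:\int f_i\,\mathrm{d}t_i(\omega')\ge 0\text{ for all }i\in N\}$ is commonly certain. A distribution $p$ is a multiplayer money pump if there exists a semi-trade $(f_i)_{i\in N}$ with $\int\sum_{i\in N}f_i\,\mathrm{d}p<0$. A strong multiplayer money pump is a strongly maximal distribution that is a multiplayer money pump. *)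

(* Defs.v *)
From mathcomp Require Import all_boot all_order all_algebra.
From mathcomp Require Import all_classical all_reals all_analysis.

Set Implicit Arguments.
Unset Strict Implicit.
Unset Printing Implicit Defensive.

Import Order.TTheory GRing.Theory Num.Theory.

Local Open Scope classical_set_scope.
Local Open Scope ring_scope.
Local Open Scope ereal_scope.

(* The state space is a [measurableType], so that Delta(Omega) is the library
   type [probability Omega R]; finiteness of Omega and measurability of all its
   subsets are assumed where needed, and nonemptiness is built in, since a
   [measurableType] is pointed. *)

(* The cell pi_i(w) is not named: "the element of Pi_i containing w" is rendered
   by quantifying over the (unique) [pi] in [cells i] with [pi w]. *)
Record info_structure (R : realType) (d : measure_display)
    (Omega : measurableType d) (n : nat) := InfoStructure {
  cells : 'I_n -> set (set Omega) ;
  belief : 'I_n -> Omega -> probability Omega R ;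
  cells_partition : forall i, partition (cells i) id [set: Omega] ;
  belief_cell : forall i (pi : set Omega) w,
    cells i pi -> pi w -> belief i w pi = 1 ;
  belief_const : forall i (pi : set Omega) w w',
    cells i pi -> pi w -> pi w' ->
    belief i w = belief i w' :> (set Omega -> \bar R) }.

Definition is_prior (R : realType) (d : measure_display)
    (Omega : measurableType d) (n : nat) (T : info_structure R Omega n)
    (i : 'I_n) (p : probability Omega R) : Prop :=
  forall (E pi : set Omega) (w : Omega), cells T i pi -> pi w ->
    p (E `&` pi) = belief T i w E * p pi.

Definition common_prior (R : realType) (d : measure_display)
    (Omega : measurableType d) (n : nat) (T : info_structure R Omega n)
    (p : probability Omega R) : Prop :=
  forall i, is_prior T i p.

Definition strongly_maximal (R : realType) (d : measure_display)
    (Omega : measurableType d) (n : nat) (T : info_structure R Omega n)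
    (p : probability Omega R) : Prop :=
  forall i (pi : set Omega), cells T i pi -> 0 < p pi.

Definition strong_common_prior (R : realType) (d : measure_display)
    (Omega : measurableType d) (n : nat) (T : info_structure R Omega n)
    (p : probability Omega R) : Prop :=
  common_prior T p /\ forall i (pi : set Omega), cells T i pi -> 0 < p pi.

Definition common_certainty_component (R : realType) (d : measure_display)
    (Omega : measurableType d) (n : nat) (T : info_structure R Omega n)
    (S : set Omega) : Prop :=
  S !=set0 /\
  forall w i, S w -> exists E : set Omega, E `<=` S /\ belief T i w E = 1.

Definition commonly_certain (R : realType) (d : measure_display)
    (Omega : measurableType d) (n : nat) (T : info_structure R Omega n)
    (E : set Omega) (w : Omega) : Prop :=
  exists S : set Omega, [/\ common_certainty_component T S, S w & S `<=` E].

Definition all_willing (R : realType) (d : measure_display)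
    (Omega : measurableType d) (n : nat) (T : info_structure R Omega n)
    (f : 'I_n -> Omega -> R) : set Omega :=
  [set w | forall i, 0 <= \int[belief T i w]_x (f i x)%:E].

Definition is_trade (R : realType) (d : measure_display)
    (Omega : measurableType d) (n : nat) (f : 'I_n -> Omega -> R) : Prop :=
  forall w, (\sum_(i < n) f i w <= 0)%R.

Definition acceptable (R : realType) (d : measure_display)
    (Omega : measurableType d) (n : nat) (T : info_structure R Omega n)
    (f : 'I_n -> Omega -> R) : Prop :=
  (forall w, commonly_certain T (all_willing T f) w) /\
  exists (w : Omega) (i : 'I_n), 0 < \int[belief T i w]_x (f i x)%:E.

Definition semi_trade (R : realType) (d : measure_display)
    (Omega : measurableType d) (n : nat) (T : info_structure R Omega n)
    (f : 'I_n -> Omega -> R) : Prop :=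
  forall w, commonly_certain T (all_willing T f) w.

Definition money_pump (R : realType) (d : measure_display)
    (Omega : measurableType d) (n : nat) (T : info_structure R Omega n)
    (p : probability Omega R) : Prop :=
  exists f : 'I_n -> Omega -> R,
    semi_trade T f /\ \int[p]_x (\sum_(i < n) f i x)%R%:E < 0.

Definition strong_money_pump (R : realType) (d : measure_display)
    (Omega : measurableType d) (n : nat) (T : info_structure R Omega n)
    (p : probability Omega R) : Prop :=
  strongly_maximal T p /\ money_pump T p.

(* Main.v *)
Require Import Defs.
From mathcomp Require Import all_boot all_order all_algebra.
From mathcomp Require Import all_classical all_reals all_analysis.
From mathcomp Require Import ring.

(** Since [Omega] itself is a common certainty component, an event is commonly
    certain at every state iff it is all of [Omega]; so a semi-trade is a family
    with nonnegative conditional expectations everywhere.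

    A distribution is a prior of player [i] with positive mass on every cell
    iff it is, up to scaling, a combination of the beliefs [t_i(w)] with
    positive coefficients. Stiemke's alternative, applied to the conditional
    expectations of zero-sum families, then yields either an acceptable
    (zero-sum) trade, or positive weights for which all players' combinations
    coincide, that is, a strong common prior. Conversely, integrating a trade
    against a strong common prior excludes acceptability, and integrating a
    semi-trade against a common prior gives a nonnegative total. Finally, if
    [p(E `&` pi) <> t_i(w)(E) p(pi)] then a multiple of [1_(E `&` pi) - t_i(w)(E) 1_pi]
    has zero conditional expectations and negative mean under [p]. *)

Set Implicit Arguments.
Unset Strict Implicit.
Unset Printing Implicit Defensive.

Import Order.TTheory GRing.Theory Num.Theory.

Local Open Scope classical_set_scope.
Local Open Scope ring_scope.

(** * Linear alternatives over an ordered field *)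

Definition dot (K : realFieldType) (X : eqType) (e : seq X) (u v : X -> K) : K :=
  \sum_(x <- e) u x * v x.

Lemma dotDl (K : realFieldType) (X : eqType) (e : seq X) (u u' v : X -> K) c :
  dot e (fun x => u x + c * u' x) v = dot e u v + c * dot e u' v.
Proof.
rewrite /dot mulr_sumr -big_split; apply: eq_bigr => x _ /=; ring.
Qed.

Lemma dotDr (K : realFieldType) (X : eqType) (e : seq X) (u v v' : X -> K) c :
  dot e u (fun x => v x + c * v' x) = dot e u v + c * dot e u v'.
Proof.
rewrite /dot mulr_sumr -big_split; apply: eq_bigr => x _ /=; ring.
Qed.

Lemma dot_self_eq0 (K : realFieldType) (X : eqType) (e : seq X) (u : X -> K) :
  dot e u u = 0 -> {in e, forall x, u x = 0}.
Proof.
move=> /eqP; rewrite /dot psumr_eq0; last by move=> x _; rewrite -expr2 sqr_ge0.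
by move=> /allP u0 x /u0 /=; rewrite mulf_eq0 orbb => /eqP.
Qed.

(* Tucker's lemma, by induction on the number of vectors: when the inductive [y]
   fails on the new vector [a c], apply the hypothesis again to the projections
   [b j] of the [a j] along [a c] onto the orthogonal of [y]. *)
Lemma tucker (K : realFieldType) (X J : eqType) (e : seq X) (a : J -> X -> K)
    (j0 : J) (s : seq J) : uniq (j0 :: s) ->
  exists (y : X -> K) (x : J -> K),
    [/\ {in j0 :: s, forall j, 0 <= dot e (a j) y}, forall j, 0 <= x j,
        {in e, forall w, \sum_(j <- j0 :: s) x j * a j w = 0} &
        0 < x j0 + dot e (a j0) y].
Proof.
elim: s a => [|c s IHs] a.
  move=> _; have dot_ge0 : 0 <= dot e (a j0) (a j0).
    by apply: sumr_ge0 => x _; rewrite -expr2 sqr_ge0.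
  have [a0|a_neq0] := eqVneq (dot e (a j0) (a j0)) 0.
    exists (fun=> 0), (fun=> 1); split=> //.
    - by move=> j _; rewrite /dot big1// => x _; rewrite mulr0.
    - by move=> w /(dot_self_eq0 a0) aw; rewrite big_seq1 aw mulr0.
    - by rewrite /dot big1 ?addr0// => x _; rewrite mulr0.
  exists (a j0), (fun=> 0); split=> //.
  - by move=> j; rewrite inE => /eqP ->.
  - by move=> w _; rewrite big_seq1 mul0r.
  - by rewrite add0r lt_neqAle eq_sym a_neq0.
rewrite [uniq _]/= inE negb_or -!andbA => /and4P[j0c j0s cs us].
have uj0s : uniq (j0 :: s) by rewrite /= j0s.
have c_notin : c \notin j0 :: s by rewrite inE eq_sym negb_or j0c.
have sum_j0cs (F : J -> K) :
    \sum_(j <- j0 :: c :: s) F j = F c + \sum_(j <- j0 :: s) F j.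
  by rewrite !big_cons addrCA.
have sum_if (F G : J -> K) z :
    \sum_(j <- j0 :: s) (if j == c then z else F j) * G j =
    \sum_(j <- j0 :: s) F j * G j.
  apply: eq_big_seq => j js; case: eqP => // jc.
  by move: c_notin; rewrite -jc js.
have [y [x [y_ge0 x_ge0 sum0 pos]]] := IHs a uj0s.
have [cy_ge0|cy_lt0] := leP 0 (dot e (a c) y).
  exists y, (fun j => if j == c then 0 else x j); split.
  - move=> j; rewrite !inE orbCA => /orP[/eqP -> //|js].
    by apply: y_ge0; rewrite inE.
  - by move=> j; case: eqP.
  - by move=> w we; rewrite sum_j0cs eqxx mul0r add0r sum_if sum0.
  - by rewrite (negPf j0c).
pose l j := dot e (a j) y / - dot e (a c) y.
pose b j w := a j w + l j * a c w.
have cy_neq0 : dot e (a c) y != 0 by rewrite lt_eqF.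
have l_ge0 j : j \in j0 :: s -> 0 <= l j.
  by move=> js; rewrite divr_ge0 ?y_ge0// oppr_ge0 ltW.
have by0 j : dot e (b j) y = 0.
  by rewrite dotDl /l; field.
have [v [u [v_ge0 u_ge0 usum0 upos]]] := IHs b uj0s.
(* With this [mu], [y'] is orthogonal to [a c]; since every [b j] is orthogonal to [y], [a j] pairs
   with [y'] exactly as [b j] pairs with [v]. *)
pose mu := - dot e (a c) v / dot e (a c) y.
pose y' w := v w + mu * y w.
have cy'0 : dot e (a c) y' = 0 by rewrite dotDr /mu; field.
have ay' j : dot e (a j) y' = dot e (b j) v.
  have : dot e (b j) y' = dot e (b j) v by rewrite dotDr by0 mulr0 addr0.
  by rewrite dotDl cy'0 mulr0 addr0.
(* The coefficient of [a c] collects the multiples [l k] added by the projections; they are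
   nonnegative because [y] fails only on [a c]. *)
exists y', (fun j => if j == c then \sum_(k <- j0 :: s) u k * l k else u j).
split.
- move=> j; rewrite !inE orbCA => /orP[/eqP ->|js]; first by rewrite cy'0.
  by rewrite ay' v_ge0// inE.
- move=> j; case: eqP => // _; rewrite big_seq; apply: sumr_ge0 => k ks.
  by rewrite mulr_ge0 ?l_ge0.
- move=> w we; rewrite sum_j0cs eqxx sum_if -[RHS](usum0 w we) addrC mulr_suml.
  by rewrite -big_split; apply: eq_bigr => j _; rewrite /= /b; ring.
- by rewrite (negPf j0c) ay'.
Qed.

(** Tucker's lemma is applied with each [j] in turn as the distinguished vector. If the first
    alternative fails, its strict inequality must come from [x j]; adding up the solutions so
    obtained makes every coefficient positive. *)
Lemma stiemke (K : realFieldType) (X J : eqType) (e : seq X) (a : J -> X -> K)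
    (s : seq J) : uniq s ->
  (exists y : X -> K, {in s, forall j, 0 <= dot e (a j) y} /\
     exists2 j, j \in s & 0 < dot e (a j) y) \/
  (exists x : J -> K, {in s, forall j, 0 < x j} /\
     {in e, forall w, \sum_(j <- s) x j * a j w = 0}).
Proof.
move=> us; have [|none] := pselect (exists y : X -> K,
  {in s, forall j, 0 <= dot e (a j) y} /\ exists2 j, j \in s & 0 < dot e (a j) y).
  by left.
right.
have /choice[F F_prop] j : exists x : J -> K, j \in s ->
    [/\ forall k, 0 <= x k, 0 < x j &
        {in e, forall w, \sum_(k <- s) x k * a k w = 0}].
  have [js|_] := boolP (j \in s); last by exists (fun=> 0).
  have us' : uniq (j :: rem j s) by rewrite -(perm_uniq (perm_to_rem js)).
  have [y [x [y_ge0 x_ge0 sum0 pos]]] := tucker e a us'.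
  exists x => _; split=> //; last first.
    by move=> w we; rewrite (perm_big _ (perm_to_rem js)) sum0.
  rewrite ltNge; apply/negP => xj_le0; apply: none; exists y; split.
    by move=> k; rewrite (perm_mem (perm_to_rem js)); apply: y_ge0.
  exists j => //; apply: lt_le_trans pos _.
  by rewrite -[leRHS]add0r lerD2r.
exists (fun k => \sum_(j <- s) F j k); split.
  move=> k ks; rewrite (big_rem k)//= ltr_wpDr//; last by have [] := F_prop k ks.
  rewrite big_seq; apply: sumr_ge0 => j /mem_rem js.
  by have [] := F_prop j js.
move=> w we; under eq_bigr do rewrite mulr_suml.
rewrite exchange_big big_seq big1//= => j js.
by have [_ _ ->] := F_prop j js.
Qed.

(** * Measures and integrals on a finite discrete space *)

Definition mass (R : realType) (d : measure_display) (Omega : measurableType d)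
  (p : probability Omega R) (x : Omega) : R := fine (p [set x]).

Lemma mass_ge0 (R : realType) (d : measure_display) (Omega : measurableType d)
  (p : probability Omega R) (x : Omega) : 0 <= mass p x.
Proof. exact: fine_ge0. Qed.

Lemma integral_mass (R : realType) (d : measure_display)
    (Omega : measurableType d) (discOmega : forall A : set Omega, measurable A)
    (e : seq Omega) (ue : uniq e) (eP : forall x, x \in e)
    (p : probability Omega R) (f : Omega -> R) :
  (\int[p]_x (f x)%:E)%E = (dot e f (mass p))%:E.
Proof.
(* Decomposing [f] into indicators of singletons reduces the integral to point masses. *)
have fE x : (f x)%:E = (\sum_(k <- e) (f k)%:E * (\1_[set k] x)%:E)%E.
  under eq_bigr do rewrite -EFinM.
  rewrite sumEFin; congr EFin; rewrite (bigD1_seq x)//= indicE mem_set// mulr1.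
  rewrite big1 ?addr0// => k kx; rewrite indicE memNset ?mulr0//= => xk.
  by move: kx; rewrite xk eqxx.
under eq_integral do rewrite fE.
rewrite integral_sum//; last first.
  by move=> k; apply: integrableZl => //; apply: integrable_indic.
rewrite /dot -sumEFin; apply: eq_bigr => k _.
rewrite integralZl//; last exact: integrable_indic.
by rewrite integral_indic// setIT EFinM /mass fineK// fin_num_measure.
Qed.

Lemma prob_mass (R : realType) (d : measure_display)
    (Omega : measurableType d) (discOmega : forall A : set Omega, measurable A)
    (e : seq Omega) (ue : uniq e) (eP : forall x, x \in e)
    (p : probability Omega R) (A : set Omega) :
  p A = (dot e \1_A (mass p))%:E.
Proof. by rewrite -integral_mass// integral_indic// setIT. Qed.

Lemma probability_of_weights (R : realType) (d : measure_display)
    (Omega : measurableType d) (e : seq Omega) (q : Omega -> R)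
    (q_ge0 : forall x, 0 <= q x) (q_gt0 : 0 < \sum_(x <- e) q x) :
  exists p : probability Omega R,
    forall A, p A = (dot e q \1_A / \sum_(x <- e) q x)%:E.
Proof.
pose mu : {measure set Omega -> \bar R} :=
  msum (fun k => mscale (NngNum (q_ge0 (nth point e k))) (dirac (nth point e k)))
    (size e).
have muE A : mu A = (dot e q \1_A)%:E.
  rewrite /mu /= /msum /dot (big_nth point) big_mkord -sumEFin.
  apply: eq_bigr => k _; rewrite EFinM.
  by [].
have muT : mu [set: Omega] = (\sum_(x <- e) q x)%:E.
  rewrite muE /dot; congr EFin; apply: eq_bigr => x _.
  by rewrite indicE in_setT mulr1.
(* The Dirac measure is only the fallback for total mass zero or infinity, excluded by [q_gt0]. *)
exists (mnormalize mu (dirac point)) => A.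
rewrite /= /mnormalize muT /= eqe gt_eqF//= muE.
by rewrite -EFinM.
Qed.

(** * Beliefs, cells and priors *)

Lemma cell_of (R : realType) (d : measure_display) (Omega : measurableType d)
    (n : nat) (T : info_structure R Omega n) (i : 'I_n) (w : Omega) :
  exists2 pi, cells T i pi & pi w.
Proof.
have [cover_cells _ _] := cells_partition T i.
have : [set: Omega] w by [].
by rewrite -cover_cells => -[pi]; exists pi.
Qed.

(** The belief at [w'] is concentrated on the cell of [w']: if that cell is [pi], intersecting with
    [pi] loses no mass and the belief is that of [w]; otherwise [pi] is disjoint from it and
    null. *)
Lemma belief_cellI (R : realType) (d : measure_display)
    (Omega : measurableType d) (discOmega : forall A : set Omega, measurable A)
    (n : nat) (T : info_structure R Omega n) (i : 'I_n) (E pi : set Omega)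
    (w w' : Omega) (piT : cells T i pi) (piw : pi w) :
  belief T i w' (E `&` pi) = (belief T i w E * (\1_pi w')%:E)%E.
Proof.
have null (A pi' : set Omega) : cells T i pi' -> pi' w' -> A `&` pi' = set0 ->
    belief T i w' A = 0%E.
  move=> piT' piw' Api'; apply/eqP; rewrite eq_le measure_ge0 andbT.
  have <- : belief T i w' (~` pi') = 0%E.
    rewrite probability_setC// (belief_cell piT' piw').
    by rewrite subee.
  apply: le_measure; rewrite ?inE//.
  by apply/disjoints_subset.
rewrite indicE; have [piw'|npiw'] := pselect (pi w').
  rewrite mem_set// mule1 (belief_const piT piw piw') [RHS](measureDI _ _ (discOmega pi))//.
  rewrite -[LHS]add0e; congr (_ + _)%E; symmetry; apply: (null _ pi) => //.
  by rewrite setDE -setIA setICl setI0.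
rewrite memNset// mule0; have [pi' piT' piw'] := cell_of T i w'.
apply: (null _ pi') => //; rewrite -setIA.
have [_ triv _] := cells_partition T i.
have [->|/set0P pipi'] := eqVneq (pi `&` pi') set0; first by rewrite setI0.
by move: npiw'; rewrite (triv pi pi').
Qed.

Lemma mass_belief (R : realType) (d : measure_display)
    (Omega : measurableType d) (discOmega : forall A : set Omega, measurable A)
    (n : nat) (T : info_structure R Omega n) (i : 'I_n) (pi : set Omega)
    (w x : Omega) (piT : cells T i pi) (pix : pi x) :
  mass (belief T i w) x = mass (belief T i x) x * \1_pi w.
Proof.
rewrite /mass -[in LHS](@setIidl _ [set x] pi); last by move=> _ ->.
by rewrite (belief_cellI discOmega _ _ piT pix) fineM// fin_num_measure.
Qed.

(** A prior is stationary for the kernel [belief T i]: only states in the cell of [x] charge [x],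
    all by the same amount, so the sum collapses to the prior identity for the event [[set x]]. *)
Lemma prior_mass (R : realType) (d : measure_display)
    (Omega : measurableType d) (discOmega : forall A : set Omega, measurable A)
    (e : seq Omega) (ue : uniq e) (eP : forall x, x \in e)
    (n : nat) (T : info_structure R Omega n) (i : 'I_n)
    (p : probability Omega R) (pP : is_prior T i p) (x : Omega) :
  mass p x = \sum_(w <- e) mass p w * mass (belief T i w) x.
Proof.
have [pi piT pix] := cell_of T i x.
under eq_bigr do rewrite (mass_belief discOmega _ piT pix).
rewrite {1}/mass -[in LHS](@setIidl _ [set x] pi); last by move=> _ ->.
rewrite (pP _ _ _ piT pix) (prob_mass discOmega ue eP p pi).
rewrite fineM ?fin_num_measure//= /dot mulr_sumr.
by apply: eq_bigr => w _; rewrite -/(mass _ _); ring.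
Qed.

(** The law of total expectation. *)
Lemma prior_mean (R : realType) (d : measure_display)
    (Omega : measurableType d) (discOmega : forall A : set Omega, measurable A)
    (e : seq Omega) (ue : uniq e) (eP : forall x, x \in e)
    (n : nat) (T : info_structure R Omega n) (i : 'I_n)
    (p : probability Omega R) (pP : is_prior T i p) (f : Omega -> R) :
  dot e f (mass p) = \sum_(w <- e) mass p w * dot e f (mass (belief T i w)).
Proof.
rewrite /dot; under [RHS]eq_bigr do rewrite mulr_sumr.
rewrite exchange_big; apply: eq_bigr => x _ /=.
rewrite (prior_mass discOmega ue eP pP) mulr_sumr.
by apply: eq_bigr => w _; ring.
Qed.

(** * Semi-trades and their means *)

Lemma semi_tradeP (R : realType) (d : measure_display)
    (Omega : measurableType d) (n : nat) (T : info_structure R Omega n)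
    (f : 'I_n -> Omega -> R) :
  semi_trade T f <->
  forall i w, (0 <= \int[belief T i w]_x (f i x)%:E)%E.
Proof.
split=> [sf i w|f_ge0 w].
  by have [S [_ Sw SE]] := sf w; apply: SE.
exists setT; split=> //; last by move=> v _ i; apply: f_ge0.
split=> [|v i _]; first by exists w.
by exists setT; split=> //; exact: probability_setT.
Qed.

Lemma prior_mean_ge0 (R : realType) (d : measure_display)
    (Omega : measurableType d) (discOmega : forall A : set Omega, measurable A)
    (e : seq Omega) (ue : uniq e) (eP : forall x, x \in e)
    (n : nat) (T : info_structure R Omega n) (f : 'I_n -> Omega -> R) (i : 'I_n)
    (p : probability Omega R) : is_prior T i p -> semi_trade T f ->
  0 <= dot e (f i) (mass p).
Proof.
move=> pP /semi_tradeP sf; rewrite (prior_mean discOmega ue eP pP).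
apply: sumr_ge0 => w _; rewrite mulr_ge0 ?mass_ge0// -lee_fin.
by rewrite -integral_mass.
Qed.

(** If the mean vanished, so would each nonnegative term of the total expectation. The conditional
    expectation is constant and positive on the cell of [w], so that cell would be null. *)
Lemma strong_prior_mean_gt0 (R : realType) (d : measure_display)
    (Omega : measurableType d) (discOmega : forall A : set Omega, measurable A)
    (e : seq Omega) (ue : uniq e) (eP : forall x, x \in e)
    (n : nat) (T : info_structure R Omega n) (f : 'I_n -> Omega -> R) (i : 'I_n)
    (w : Omega) (p : probability Omega R) :
  is_prior T i p -> strongly_maximal T p -> semi_trade T f ->
  (0 < \int[belief T i w]_x (f i x)%:E)%E ->
  0 < dot e (f i) (mass p).
Proof.
move=> pP pmax sf; rewrite (integral_mass discOmega ue eP) lte_fin => fw.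
rewrite lt_neqAle (prior_mean_ge0 discOmega ue eP pP sf) andbT.
rewrite eq_sym; apply/eqP; rewrite (prior_mean discOmega ue eP pP) => /eqP.
move/semi_tradeP : sf => sf.
rewrite psumr_eq0; last first.
  move=> v _; rewrite mulr_ge0 ?mass_ge0// -lee_fin.
  by rewrite -integral_mass.
move=> /allP null; have [pi piT piw] := cell_of T i w.
have := pmax i pi piT; rewrite (prob_mass discOmega ue eP) lte_fin /dot big1 ?ltxx//.
move=> v _; rewrite indicE; have [piv|npiv] := pselect (pi v); last first.
  by rewrite memNset ?mul0r.
have := null v (eP v); rewrite /= mulf_eq0 => /orP[/eqP ->|]; first by rewrite mulr0.
rewrite /mass -(belief_const piT piw piv) -/(mass _).
by rewrite gt_eqF.
Qed.

Lemma not_prior_semi_trade (R : realType) (d : measure_display)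
    (Omega : measurableType d) (discOmega : forall A : set Omega, measurable A)
    (e : seq Omega) (ue : uniq e) (eP : forall x, x \in e)
    (n : nat) (T : info_structure R Omega n) (i : 'I_n)
    (p : probability Omega R) : ~ is_prior T i p -> money_pump T p.
Proof.
move=> /existsNP[E /existsNP[pi /existsNP[w /not_implyP[piT /not_implyP[piw pE]]]]].
pose t := fine (belief T i w E).
pose h x : R := \1_(E `&` pi) x - t * \1_pi x.
have meanE (q : probability Omega R) :
    dot e h (mass q) = fine (q (E `&` pi)) - t * fine (q pi).
  rewrite /h !(prob_mass discOmega ue eP) /= /dot mulr_sumr -sumrB.
  by apply: eq_bigr => x _; ring.
have mean0 v : dot e h (mass (belief T i v)) = 0.
  (* With [pi] read as its intersection with the whole space, both terms become [t] times the
     indicator of [pi] at [v]. *)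
  rewrite meanE (belief_cellI discOmega _ _ piT piw) -[pi in X in _ - X]setTI.
  rewrite (belief_cellI discOmega _ _ piT piw) probability_setT mul1e.
  by rewrite fineM ?fin_num_measure//= subrr.
have hp : dot e h (mass p) != 0.
  rewrite meanE subr_eq0; apply: contra_notN pE => /eqP pE.
  rewrite -[LHS]fineK ?fin_num_measure// pE EFinM /t !fineK// fin_num_measure//.
(* This factor makes the mean minus a nonzero square, whatever the sign of the mean of [h]; only
   player [i] trades. *)
pose c := - dot e h (mass p).
exists (fun j x => if j == i then c * h x else 0); split.
  apply/semi_tradeP => j v; rewrite (integral_mass discOmega ue eP) lee_fin.
  rewrite /dot; case: eqP => [->|_]; last first.
    by rewrite big1// => x _; rewrite mul0r.
  under eq_bigr do rewrite -mulrA.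
  by rewrite -mulr_sumr -/(dot _ _ _) mean0 mulr0.
rewrite (integral_mass discOmega ue eP) lte_fin /dot.
under eq_bigr do rewrite -big_mkcond big_pred1_eq -mulrA.
rewrite -mulr_sumr -/(dot _ _ _) /c mulNr oppr_lt0 -expr2.
by rewrite lt_neqAle sqr_ge0 andbT eq_sym expf_eq0.
Qed.

(** * From the alternative to a trade or a strong common prior *)

Lemma trade_or_weights (R : realType) (d : measure_display)
    (Omega : measurableType d) (discOmega : forall A : set Omega, measurable A)
    (e : seq Omega) (ue : uniq e) (eP : forall x, x \in e)
    (n : nat) (n_gt0 : (0 < n)%N) (T : info_structure R Omega n) :
  (exists f : 'I_n -> Omega -> R, is_trade f /\ acceptable T f) \/
  (exists lam : 'I_n -> Omega -> R, (forall i w, 0 < lam i w) /\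
    forall i j x, \sum_(w <- e) lam i w * mass (belief T i w) x =
                  \sum_(w <- e) lam j w * mass (belief T j w) x).
Proof.
pose s := [seq (i, x) | i <- index_enum 'I_n, x <- e].
have us : uniq s.
  apply: allpairs_uniq => //; first exact: index_enum_uniq.
  by move=> [? ?] [? ?] _ _ [-> ->].
have sP k : k \in s.
  by case: k => i x; apply: allpairs_f; rewrite ?mem_index_enum ?eP.
(* [a (i, w)] is the conditional expectation of player [i] at [w], composed with
   the map [y |-> n y_i - \sum_j y_j] onto zero-sum families. *)
pose a (k l : 'I_n * Omega) : R :=
  mass (belief T k.1 k.2) l.2 * (n%:R * (l.1 == k.1)%:R - 1).
have [[y [y_ge0 [[i w] _ yiw]]]|[lam [lam_gt0 lam0]]] := stiemke s a us.
- left; pose f i x : R := n%:R * y (i, x) - \sum_(j < n) y (j, x).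
  have dotE k v : dot s (a (k, v)) y = dot e (f k) (mass (belief T k v)).
    rewrite /dot big_allpairs exchange_big; apply: eq_bigr => x _ /=.
    rewrite /a /f /=.
    under eq_bigr do rewrite -mulrA mulrBl mul1r.
    rewrite -mulr_sumr mulrC sumrB; congr ((_ - _) * _).
    rewrite (bigD1 k)//= eqxx mulr1 big1 ?addr0// => j jk.
    by rewrite (negPf jk) mulr0 mul0r.
  have f_semi : semi_trade T f.
    apply/semi_tradeP => k v; rewrite (integral_mass discOmega ue eP) lee_fin.
    by rewrite -dotE y_ge0.
  exists f; split.
    move=> x; rewrite /f sumrB -mulr_sumr sumr_const card_ord mulr_natl.
    by rewrite subrr.
  split=> //; exists w, i.
  by rewrite (integral_mass discOmega ue eP) lte_fin -dotE.
- right; exists (fun i w => lam (i, w)); split=> [i w|]; first exact: lam_gt0.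
  (* The equation at coordinate [(i, x)] says that [n] times player [i]'s combination is the sum
     over all players, which does not depend on [i]. *)
  have nS i x : n%:R * (\sum_(w <- e) lam (i, w) * mass (belief T i w) x) =
      \sum_j \sum_(w <- e) lam (j, w) * mass (belief T j w) x.
    apply/eqP; rewrite -subr_eq0 -[X in _ == X](lam0 (i, x))// big_allpairs /=.
    rewrite eq_sym; apply/eqP; rewrite /a /=.
    under eq_bigr => j _.
      under eq_bigr do rewrite mulrA mulrBr mulr1.
      rewrite sumrB -mulr_suml.
      over.
    rewrite sumrB (bigD1 i)//= eqxx mulr1 mulrC; congr (_ - _).
    rewrite [X in _ + X]big1 ?addr0// => j ji.
    by rewrite eq_sym (negPf ji) !mulr0.
  move=> i j x; apply: (@mulfI _ n%:R); first by rewrite pnatr_eq0 -lt0n.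
  by rewrite !nS.
Qed.

Lemma strong_prior_of_weights (R : realType) (d : measure_display)
    (Omega : measurableType d) (discOmega : forall A : set Omega, measurable A)
    (e : seq Omega) (ue : uniq e) (eP : forall x, x \in e)
    (n : nat) (n_gt0 : (0 < n)%N) (T : info_structure R Omega n)
    (lam : 'I_n -> Omega -> R) (lam_gt0 : forall i w, 0 < lam i w)
    (lamE : forall i j x, \sum_(w <- e) lam i w * mass (belief T i w) x =
                          \sum_(w <- e) lam j w * mass (belief T j w) x) :
  exists p : probability Omega R, strong_common_prior T p.
Proof.
pose q x := \sum_(w <- e) lam (Ordinal n_gt0) w * mass (belief T (Ordinal n_gt0) w) x.
(* By [lamE] the weight [q], defined through player 0, can be expanded with the beliefs of whichever
   player is being checked. *)
have qE i A : dot e q \1_A = \sum_(w <- e) lam i w * fine (belief T i w A).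
  rewrite /dot; under eq_bigr do rewrite /q (lamE _ i) mulr_suml.
  rewrite exchange_big; apply: eq_bigr => w _ /=.
  rewrite (prob_mass discOmega ue eP) /= /dot mulr_sumr.
  by apply: eq_bigr => x _; ring.
(* Only the beliefs held inside [pi] charge [pi], and they all agree: this is the prior identity
   before normalization. *)
have q_cell i (E pi : set Omega) w : cells T i pi -> pi w ->
    dot e q \1_(E `&` pi) = fine (belief T i w E) * dot e (lam i) \1_pi.
  move=> piT piw; rewrite (qE i) /dot mulr_sumr; apply: eq_bigr => v _.
  rewrite (belief_cellI discOmega _ _ piT piw) fineM ?fin_num_measure//=.
  ring.
have q_cell_gt0 i (pi : set Omega) : cells T i pi -> 0 < dot e (lam i) \1_pi.
  move=> piT; have [_ _ /(_ pi piT)[w piw]] := cells_partition T i.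
  rewrite /dot (bigD1_seq w)//= indicE mem_set// mulr1 ltr_wpDr//.
  by apply: sumr_ge0 => v _; rewrite mulr_ge0// ltW.
have q_ge0 x : 0 <= q x.
  by apply: sumr_ge0 => w _; rewrite mulr_ge0 ?mass_ge0// ltW.
have q_gt0 : 0 < \sum_(x <- e) q x.
  have -> : \sum_(x <- e) q x = dot e q \1_[set: Omega].
    by apply: eq_bigr => x _; rewrite indicE in_setT mulr1.
  rewrite (qE (Ordinal n_gt0)) (bigD1_seq (point : Omega))//=.
  rewrite probability_setT mulr1 ltr_wpDr//.
  by apply: sumr_ge0 => v _; rewrite probability_setT mulr1 ltW.
have [p pE] := probability_of_weights q_ge0 q_gt0.
have pcell i (E pi : set Omega) w : cells T i pi -> pi w ->
    p (E `&` pi) = (fine (belief T i w E) *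
                    (dot e (lam i) \1_pi / \sum_(x <- e) q x))%:E.
  by move=> piT piw; rewrite pE (q_cell _ _ _ _ piT piw) mulrA.
have pcellT i (pi : set Omega) : cells T i pi ->
    p pi = (dot e (lam i) \1_pi / \sum_(x <- e) q x)%:E.
  move=> piT; have [_ _ /(_ pi piT)[w piw]] := cells_partition T i.
  by rewrite -[pi in LHS]setTI (pcell _ _ _ _ piT piw) probability_setT mul1r.
exists p; split.
  move=> i E pi w piT piw; rewrite (pcell _ _ _ _ piT piw) (pcellT i pi)//.
  by rewrite EFinM fineK// fin_num_measure.
by move=> i pi piT; rewrite (pcellT i pi)// lte_fin divr_gt0// q_cell_gt0.
Qed.

Theorem theorem61 (R : realType) (d : measure_display)
    (Omega : measurableType d)
    (finOmega : finite_set [set: Omega])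
    (discOmega : forall A : set Omega, measurable A)
    (n : nat) (n_gt0 : (0 < n)%N)
    (T : info_structure R Omega n) :
  ((~ exists p : probability Omega R, strong_common_prior T p) <->
   (exists f : 'I_n -> Omega -> R, is_trade f /\ acceptable T f)) /\
  ((exists f : 'I_n -> Omega -> R, is_trade f /\ acceptable T f) <->
   (forall p : probability Omega R,
      strongly_maximal T p -> strong_money_pump T p)).
Proof.
have [e [ue eP]] : exists e : seq Omega, uniq e /\ forall x, x \in e.
  have /finite_seqP[s sE] := finOmega; exists (undup s).
  split=> [|x]; first exact: undup_uniq.
  by rewrite mem_undup; have : [set: Omega] x by []; rewrite sE.
have sum_mean (p : probability Omega R) (f : 'I_n -> Omega -> R) :
    dot e (fun x => \sum_(i < n) f i x) (mass p) =
    \sum_(i < n) dot e (f i) (mass p).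
  rewrite /dot; under eq_bigr do rewrite mulr_suml.
  by rewrite exchange_big.
have trade12 : ~ (exists p : probability Omega R, strong_common_prior T p) ->
    exists f : 'I_n -> Omega -> R, is_trade f /\ acceptable T f.
  move=> noprior; have [//|[lam [lam_gt0 lamE]]] :=
    trade_or_weights discOmega ue eP n_gt0 T.
  exact: False_ind (noprior (strong_prior_of_weights discOmega ue eP n_gt0 lam_gt0 lamE)).
have trade21 : (exists f : 'I_n -> Omega -> R, is_trade f /\ acceptable T f) ->
    ~ exists p : probability Omega R, strong_common_prior T p.
  (* The first clause of [acceptable] is [semi_trade] by conversion. The mean of the total is then
     at most zero by the trade condition, yet positive because of player [i]. *)
  move=> [f [f_trade [f_semi [w [i fiw]]]]] [p [p_prior p_max]].
  have : dot e (fun x => \sum_(i < n) f i x) (mass p) <= 0.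
    by apply: sumr_le0 => x _; rewrite mulr_le0_ge0 ?mass_ge0.
  rewrite sum_mean (bigD1 i)//= leNgt ltr_wpDr//.
    apply: sumr_ge0 => j _.
    exact: (prior_mean_ge0 discOmega ue eP (p_prior j) f_semi).
  exact: (strong_prior_mean_gt0 discOmega ue eP (p_prior i) p_max f_semi fiw).
split; [by split|split].
  move=> /trade21 noprior p p_max; split=> //.
  have [p_prior|/existsNP[i not_prior]] := pselect (common_prior T p).
    by case: noprior; exists p.
  exact: (not_prior_semi_trade discOmega ue eP not_prior).
(* A strong common prior is strongly maximal, so it would be pumped, although every semi-trade has
   nonnegative mean under it. *)
move=> pump; apply: trade12 => -[p [p_prior p_max]].
have [_ [f [f_semi]]] := pump p p_max.
rewrite (integral_mass discOmega ue eP) lte_fin sum_mean ltNge sumr_ge0// => i _.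
exact: (prior_mean_ge0 discOmega ue eP (p_prior i) f_semi).
Qed.
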